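(* Let $N=4$, $L>0$, and let $Y=(y_1,\dots,y_4)$ be points in $\mathbb{R}^3$ with $|y_j-y_{j'}|=L$ for all $j\neq j'$. Then a frequency $f\in\mathbb{R}$ is achievable over $\mathbb{F}_{\overline{\mathbb{R}}}$ exactly when $f\neq\pm l\pi/L$ for all $l\in\mathbb{N}=\{1,2,\dots\}$. The minimal decay function $\mathfrak{r}(f)=\mathfrak{r}_{\min}(f;\mathbb{F}_{\overline{\mathbb{R}}})$ is given by $$\mathfrak{r}(0)=0,\qquad \mathfrak{r}(f)=\frac1L\ln\frac{Lf}{\sin(Lf)}\quad\text{for } f\in\pm\bigcup_{l=0}^{\infty}\left(\frac{2l\pi}{L},\frac{(2l+1)\pi}{L}\right),$$ $$\mathfrak{r}(f)=\frac1L\ln\frac{-Lf}{3\sin(Lf)}\quad\text{for } f\in\pm\bigcup_{l\in\mathbb{N}}\left(\frac{(2l-1)\pi}{L},\frac{2l\pi}{L}\right).$$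
   Context: Notation: $\mathbb{C}_-=\{z\in\mathbb{C}:\mathrm{Im}\,z<0\}$, $\overline{\mathbb{R}}=\mathbb{R}\cup\{\infty\}$; $\pm U$ means $U\cup(-U)$. For $x\in\mathbb{R}^3\setminus\{0\}$ and $z\in\mathbb{C}$ put $G_z(x)=\frac{e^{\mathrm{i}z|x|}}{4\pi|x|}$. For $\alpha\in\mathbb{C}^N$, $\Gamma_{\alpha,Y}(z)$ is the $N\times N$ matrix with diagonal entries $\alpha_j-\frac{\mathrm{i}z}{4\pi}$ and off-diagonal entries $-G_z(y_j-y_{j'})$, $j\ne j'$. For $\alpha\in(\mathbb{C}\cup\{\infty\})^N$ one sets $\det\Gamma_{\alpha,Y}(z):=\det\Gamma_{\widetilde\alpha,\widetilde Y}(z)$, where $\widetilde\alpha,\widetilde Y$ are obtained from $\alpha,Y$ by deleting the components with indices $j$ such that $\alpha_j=\infty$ (the determinant of the empty matrix is $1$). $\Sigma(\alpha,Y)\subset\mathbb{C}$ denotes the set of zeros of $\det\Gamma_{\alpha,Y}(\cdot)$, and $\Sigma_{\mathrm{res}}(\alpha,Y):=\Sigma(\alpha,Y)\cap(\mathbb{C}_-\cup\mathbb{R})$ is the set of resonances of the point-interaction Hamiltonian $H_\alpha=-\Delta_{\alpha,Y}$. $\mathbb{F}_{\overline{\mathbb{R}}}=\{H_\alpha:\alpha\in\overline{\mathbb{R}}^N\}$ and $\Sigma_{\mathrm{res}}[\mathbb{F}_{\overline{\mathbb{R}}}]=\bigcup_{\alpha\in\overline{\mathbb{R}}^N}\Sigma_{\mathrm{res}}(\alpha,Y)$.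 A real $f$ is an achievable frequency over $\mathbb{F}_{\overline{\mathbb{R}}}$ if $f=\mathrm{Re}\,k$ for some $k\in\Sigma_{\mathrm{res}}[\mathbb{F}_{\overline{\mathbb{R}}}]$; then $\mathfrak{r}_{\min}(f;\mathbb{F}_{\overline{\mathbb{R}}}):=\inf\{\mathfrak{r}\in[0,+\infty): f-\mathrm{i}\mathfrak{r}\in\Sigma_{\mathrm{res}}[\mathbb{F}_{\overline{\mathbb{R}}}]\}$. *)

(* Defs.v *)
From HB Require Import structures.
From mathcomp Require Import all_boot all_order all_algebra.
From mathcomp Require Import all_classical all_reals all_analysis.
From mathcomp Require Import complex.

Set Implicit Arguments.
Unset Strict Implicit.
Unset Printing Implicit Defensive.

Import Order.TTheory GRing.Theory Num.Theory.
Local Open Scope classical_set_scope.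
Local Open Scope ring_scope.
Local Open Scope complex_scope.

(* complex.Re and complex.Im are R-valued, and 'i%C is literally 0 +i* 1 (plain
   'i would be the abstract imaginary unit of the numClosedFieldType R[i]). *)

Definition cexp (R : realType) (z : R[i]) : R[i] :=
  (expR (complex.Re z))%:C *
  (cos (complex.Im z) +i* sin (complex.Im z)).

(* The library norm `|x| on 'rV[R]_n is the sup norm, hence this one. *)
Definition enorm (R : realType) (n : nat) (x : 'rV[R]_n) : R :=
  Num.sqrt (\sum_(i < n) x ord0 i ^+ 2).

Definition green (R : realType) (z : R[i]) (x : 'rV[R]_3) : R[i] :=
  cexp ('i%C * z * (enorm x)%:C) / (4 * pi * enorm x)%:C.

Definition Gamma (R : realType) (N : nat) (alpha : 'I_N -> R[i])
    (Y : 'I_N -> 'rV[R]_3) (z : R[i]) : 'M[R[i]]_N :=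
  \matrix_(j, j') if j == j' then alpha j - 'i%C * z / (4 * pi)%:C
                  else - green z (Y j - Y j').

(* C \cup {oo} is rendered as option R[i], with None for oo. The surviving
   indices are renumbered increasingly by enum_val; the default value 0 below
   is never used. *)
Definition finite_idx (R : realType) (N : nat) (alpha : 'I_N -> option R[i]) :
  {set 'I_N} := [set j | alpha j != None].

Definition del_alpha (R : realType) (N : nat) (alpha : 'I_N -> option R[i])
    (j : 'I_#|finite_idx alpha|) : R[i] :=
  odflt 0 (alpha (enum_val j)).

Definition del_Y (R : realType) (N : nat) (alpha : 'I_N -> option R[i])
    (Y : 'I_N -> 'rV[R]_3) (j : 'I_#|finite_idx alpha|) : 'rV[R]_3 :=
  Y (enum_val j).

Definition det_Gamma (R : realType) (N : nat) (alpha : 'I_N -> option R[i])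
    (Y : 'I_N -> 'rV[R]_3) (z : R[i]) : R[i] :=
  \det (Gamma (@del_alpha R N alpha) (@del_Y R N alpha Y) z).

Definition Sigma (R : realType) (N : nat) (alpha : 'I_N -> option R[i])
    (Y : 'I_N -> 'rV[R]_3) : set R[i] :=
  [set z | det_Gamma alpha Y z = 0].

Definition lower_half_plane (R : realType) : set R[i] :=
  [set z | complex.Im z < 0].

Definition real_line (R : realType) : set R[i] := range (fun x : R => x%:C).

Definition Sigma_res (R : realType) (N : nat) (alpha : 'I_N -> option R[i])
    (Y : 'I_N -> 'rV[R]_3) : set R[i] :=
  Sigma alpha Y `&` (@lower_half_plane R `|` @real_line R).

(* A family of Hamiltonians H_alpha (Y being fixed) is given by its set of
   parameters alpha; this one is that of all alpha in (R \cup {oo})^N. *)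
Definition F_Rbar (R : realType) (N : nat) : set ('I_N -> option R[i]) :=
  range (fun (a : 'I_N -> option R) (j : 'I_N) =>
           omap (fun x : R => x%:C) (a j)).

Definition Sigma_res_family (R : realType) (N : nat)
    (F : set ('I_N -> option R[i])) (Y : 'I_N -> 'rV[R]_3) : set R[i] :=
  \bigcup_(alpha in F) Sigma_res alpha Y.

Definition achievable (R : realType) (N : nat)
    (F : set ('I_N -> option R[i])) (Y : 'I_N -> 'rV[R]_3) (f : R) : Prop :=
  exists2 k : R[i], Sigma_res_family F Y k & f = complex.Re k.

(* For achievable f this is the infimum of a nonempty set of nonnegative reals;
   for other f it takes the irrelevant value inf set0. *)
Definition r_min (R : realType) (N : nat)
    (F : set ('I_N -> option R[i])) (Y : 'I_N -> 'rV[R]_3) (f : R) : R :=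
  inf [set r : R | 0 <= r /\ Sigma_res_family F Y (f%:C - 'i%C * r%:C)].

Definition pm (R : realType) (U : set R) : set R := U `|` [set - x | x in U].

(* Main.v *)
Require Import Defs.
From HB Require Import structures.
From mathcomp Require Import all_boot all_order all_algebra.
From mathcomp Require Import all_classical all_reals all_analysis.
From mathcomp Require Import complex.
From mathcomp Require Import ring lra.

Set Implicit Arguments.
Unset Strict Implicit.
Unset Printing Implicit Defensive.

Import Order.TTheory GRing.Theory Num.Theory.
Local Open Scope classical_set_scope.
Local Open Scope ring_scope.


(** Write a candidate resonance as z = f - i r with r >= 0. All mutual distances
being L, the matrix Gamma(z) has all its off-diagonal entries equal to -e, where
e = exp(izL) / (4 pi L); it is therefore D - e J, with D diagonal and J the
all-ones matrix. For real alpha the entries of D have arbitrary real parts but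
share one imaginary part, Im e - f / (4 pi).

If v is a kernel vector, then pairing the equation with the conjugate of v and
taking imaginary parts removes the real parameters alpha and leaves
(Im e - f / (4 pi)) |v|^2 = |sum v|^2 Im e. By Cauchy-Schwarz the ratio
t = |sum v|^2 / |v|^2 lies in [0, n], where n <= N is the number of finite
parameters. Multiplying out, every resonance f - i r satisfies
   L f = (1 - t) exp(L r) sin(L f)   for some t in [0, N]
([resonance_frequency]). Conversely the two extreme values of t are reached with
all alpha_j equal to one real number: t = 0 makes D = 0, so that all rows of
Gamma coincide, and t = N makes D = N e, so that the constant vector lies in the
kernel ([resonance_at_extreme]).

It remains to minimise rho = exp(L r) >= 1 in x = (1 - t) rho sin x, where
x = L f and 0 <= t <= 4. If x and sin x have the same sign, then t < 1, and rho
is least at t = 0, where rho = x / sin x; this is at least 1 since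
|sin x| <= |x|. If they have opposite signs, then t > 1, and rho is least at
t = 4, where rho = - x / (3 sin x); this is at least 1 since then |x| is larger
than pi, which forces 3 |sin x| <= |x|. If sin x = 0, only x = 0 is possible,
and there r = 0 is attained. *)

(** * Matrices with constant off-diagonal entries *)

Section ConstantCoupling.
Local Open Scope complex_scope.

(** Cauchy-Schwarz against the all-ones vector, from the nonnegativity of the
sum of all (a_i - a_j)^2. *)
Lemma sqr_sum_le (R : realFieldType) (n : nat) (a : 'I_n -> R) :
  (\sum_i a i) ^+ 2 <= n%:R * \sum_i a i ^+ 2.
Proof.
have -> : n%:R * \sum_i a i ^+ 2 = \sum_(i < n) \sum_(j < n) a j ^+ 2.
  by rewrite sumr_const card_ord mulr_natl.
have H : 0 <= \sum_(i < n) \sum_(j < n) (a i - a j) ^+ 2.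
  by apply: sumr_ge0 => i _; apply: sumr_ge0 => j _; exact: sqr_ge0.
have E : \sum_(i < n) \sum_(j < n) (a i - a j) ^+ 2 =
  \sum_(i < n) \sum_(j < n) a i ^+ 2 + \sum_(i < n) \sum_(j < n) a j ^+ 2
  - 2 * (\sum_i a i) ^+ 2.
  rewrite expr2 mulr_suml mulr_sumr -!big_split -sumrB /=.
  apply: eq_bigr => i _; rewrite !mulr_sumr -!big_split -sumrB /=.
  by apply: eq_bigr => j _; ring.
move: H; rewrite E [X in X + _ - _]exchange_big /= => H.
lra.
Qed.

Lemma ReD (R : rcfType) : {morph @complex.Re R : a b / a + b}.
Proof. by case=> a b []. Qed.

Lemma ImD (R : rcfType) : {morph @complex.Im R : a b / a + b}.
Proof. by case=> a b []. Qed.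

Definition coupling (R : realType) (n : nat) (d : 'I_n -> R[i]) (e : R[i]) :
    'M[R[i]]_n :=
  \matrix_(j, k) ((if j == k then d j else 0) - e).

Lemma mul_coupling (R : realType) (n : nat) (d : 'I_n -> R[i]) (e : R[i])
    (v : 'rV[R[i]]_n) (k : 'I_n) :
  (v *m coupling d e) 0 k = v 0 k * d k - (\sum_j v 0 j) * e.
Proof.
rewrite !mxE (eq_bigr (fun j => (if j == k then v 0 j * d j else 0) - v 0 j * e)).
  by rewrite sumrB -big_mkcond /= big_pred1_eq mulr_suml.
by move=> j _; rewrite mxE mulrBr; case: ifP => _; rewrite ?mulr0.
Qed.

(** The quadratic form vanishes at a kernel vector v, and its imaginary part does
not see the real parts x_j; t is |sum v|^2 / |v|^2. *)
Lemma singular_coupling_Im (R : realType) (n : nat) (x : 'I_n -> R) (y : R)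
    (e : R[i]) :
  \det (coupling (fun j => x j +i* y) e) = 0 ->
  exists2 t : R, 0 <= t <= n%:R & y = t * complex.Im e.
Proof.
move=> /eqP /det0P [v vN0 vM].
pose s := \sum_j v 0 j.
pose V := \sum_j (complex.Re (v 0 j) ^+ 2 + complex.Im (v 0 j) ^+ 2).
have eqk k : v 0 k * (x k +i* y) = s * e.
  have := mul_coupling (fun j => x j +i* y) e v k.
  by rewrite vM mxE => /esym/subr0_eq.
(* Multiply the k-th kernel equation by the conjugate of v_k, sum over k and take
   imaginary parts. *)
have s2E : y * V = (complex.Re s ^+ 2 + complex.Im s ^+ 2) * complex.Im e.
  transitivity (complex.Im (s * e * s^*)); last first.
    by case: (s) (e) => a b [c d] /=; ring.
  rewrite {2}/s rmorph_sum mulr_sumr mulr_sumr.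
  rewrite (big_morph _ (@ImD R) (id1 := 0)) //; apply: eq_bigr => k _.
  by rewrite -(eqk k); case: (v 0 k) => a b /=; ring.
have V_gt0 : 0 < V.
  rewrite lt_def sumr_ge0 ?andbT => [|j _]; last by rewrite addr_ge0 ?sqr_ge0.
  apply: contra vN0; rewrite psumr_eq0 => [/allP H|j _]; last first.
    by rewrite addr_ge0 ?sqr_ge0.
  apply/eqP/rowP => j; rewrite !mxE.
  have := H j (mem_index_enum _); rewrite /= paddr_eq0 ?sqr_ge0 // !sqrf_eq0.
  by case: (v 0 j) => a b /= /andP[/eqP -> /eqP ->].
have s2_le : complex.Re s ^+ 2 + complex.Im s ^+ 2 <= n%:R * V.
  rewrite /s (big_morph _ (@ReD R) (id1 := 0)) // (big_morph _ (@ImD R) (id1 := 0)) //.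
  by rewrite /V big_split /= mulrDr lerD ?sqr_sum_le.
exists ((complex.Re s ^+ 2 + complex.Im s ^+ 2) / V).
  by rewrite ler_pdivrMr // s2_le divr_ge0 ?(ltW V_gt0) // addr_ge0 ?sqr_ge0.
by rewrite mulrAC -s2E mulfK ?gt_eqF.
Qed.

(** These diagonals realise the two ends t = 0 and t = n of the range in
[singular_coupling_Im]. *)
Lemma coupling_singular (R : realType) (n : nat) (d e : R[i]) :
  (1 < n)%N -> d = 0 \/ d = n%:R * e -> \det (coupling (fun _ : 'I_n => d) e) = 0.
Proof.
move=> n_gt1 [->|->].
  (* All rows are equal, and there are at least two of them. *)
  apply: (@determinant_alternate _ _ _ (Ordinal (ltnW n_gt1)) (Ordinal n_gt1)) => //.
  by move=> k; rewrite !mxE !if_same.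
apply/eqP/det0P; exists (const_mx 1).
  by apply/rV0Pn; exists (Ordinal n_gt1); rewrite mxE oner_eq0.
apply/rowP => k; rewrite mul_coupling !mxE mul1r.
under eq_bigr do rewrite mxE.
by rewrite sumr_const card_ord subrr.
Qed.

End ConstantCoupling.

(** * The sign and the size of the sine *)

Section Sine.
Import numFieldNormedType.Exports.
Variable R : realType.
Implicit Types x : R.

Lemma sin_le_id x : 0 <= x -> sin x <= x.
Proof.
move=> x_ge0.
have sinC : {within `[0, x], continuous (@sin R)}.
  by apply: derivable_within_continuous => y _; exact: derivable_sin.
have [c _] := MVT_segment x_ge0 (fun y _ => is_derive_sin y) sinC.
rewrite sin0 !subr0 => ->; exact: ler_piMl (cos_le1 c).
Qed.

(** Reduction modulo pi of a nonnegative angle: every sign and zero of the sine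
is read off from the sign of sin on [0, pi). *)
Lemma sin_half_turns x : 0 <= x -> exists n u,
  [/\ 0 <= u < pi, x = u + n%:R * pi & sin x = (-1) ^+ n * sin u].
Proof.
move=> x_ge0; pose n := Num.truncn (x / pi); exists n, (x - n%:R * pi).
have /truncn_itv/andP[] : 0 <= x / pi by rewrite divr_ge0 ?pi_ge0.
rewrite -/n ler_pdivlMr ?pi_gt0 // ltr_pdivrMr ?pi_gt0 // => nx xn; split.
- by rewrite subr_ge0 nx ltrBlDr; move: xn; rewrite mulrSr mulrDl mul1r addrC.
- by rewrite subrK.
by rewrite -(alternatingn (@sinDpi R)) -[pi *+ n]mulr_natl subrK.
Qed.


Lemma sin_eq0_ge0 x : 0 <= x -> sin x = 0 -> exists n, x = n%:R * pi.
Proof.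
move=> /sin_half_turns[n [u [/andP[u_ge0 u_lt] -> ->]]] /eqP.
rewrite mulf_eq0 signr_eq0 /= => /eqP su0; exists n.
move: u_ge0; rewrite le_eqVlt => /predU1P[<-|u_gt0]; first by rewrite add0r.
by have := @sin_gt0_pi _ u; rewrite u_gt0 u_lt su0 ltxx => /(_ isT).
Qed.

Lemma signed_sin_gt0 x n : n%:R * pi < x < (n%:R + 1) * pi ->
  0 < (-1) ^+ n * sin x.
Proof.
move=> /andP[nx xn].
rewrite -[x](subrK (pi *+ n)) (alternatingn (@sinDpi R)) mulrA -expr2 sqrr_sign.
by rewrite mul1r sin_gt0_pi // -[pi *+ n]mulr_natl; apply/andP; split; lra.
Qed.

Lemma norm_sin_le x : `|sin x| <= `|x|.
Proof.
wlog x_ge0 : x / 0 <= x => [H|].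
  case: (leP 0 x) => [/H //|x_lt0]; rewrite -normrN -sinN -(normrN x).
  by apply: H; lra.
rewrite (ger0_norm x_ge0); case: (leP 1 x) => [|x_lt1].
  exact: le_trans (sin_max x).
rewrite ger0_norm ?sin_le_id // sin_ge0_pi // x_ge0 /=.
by have := @pi_ge2 R; lra.
Qed.

(** The sine has the sign opposite to x only for |x| > pi. Writing |x| >= pi + u
with u in [0, pi), the bounds sin u <= u and sin u <= 1 give
3 sin u <= 2 + u, so the crude estimate pi >= 2 is enough. *)
Lemma norm_sin3_le x : x * sin x < 0 -> 3 * `|sin x| <= `|x|.
Proof.
wlog x_ge0 : x / 0 <= x => [H|].
  case: (leP 0 x) => [/H //|x_lt0 xs]; rewrite -(normrN (sin x)) -sinN -(normrN x).
  by apply: H; rewrite ?sinN; lra.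
have [[|n] [u [/andP[u_ge0 u_lt] xE sE]]] := sin_half_turns x_ge0.
  rewrite sE expr0 mul1r xE mul0r addr0 => us_lt0.
  by have := @sin_ge0_pi _ u; rewrite u_ge0 (ltW u_lt) => /(_ isT); nra.
move=> _; have su_ge0 : 0 <= sin u by rewrite sin_ge0_pi // u_ge0 ltW.
rewrite (ger0_norm x_ge0) sE normrM normrX normrN1 expr1n mul1r ger0_norm //.
have := sin_le_id u_ge0; have := sin_le1 u; have := @pi_ge2 R.
have : pi <= n.+1%:R * pi :> R by rewrite ler_peMl ?pi_ge0 // ler1n.
by rewrite xE; lra.
Qed.

End Sine.

(** * Resonances of equidistant centres *)

Section Resonances.
Local Open Scope complex_scope.
Variables (R : realType) (L : R) (L_gt0 : 0 < L).

(** The Green function G_z at distance L, for z = f - i r. *)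
Definition green_value (f r : R) : R[i] :=
  expR (L * r) / (4 * pi * L) * cos (L * f) +i*
  (expR (L * r) / (4 * pi * L) * sin (L * f)).

Lemma divc_real (a b c : R) : (a +i* b) / c%:C = (a / c) +i* (b / c).
Proof.
rewrite -fmorphV; apply/eqP; rewrite eq_complex /=.
by apply/andP; split; apply/eqP; ring.
Qed.

Lemma mul_i_lower (f r : R) : 'i%C * (f%:C - 'i%C * r%:C) = r +i* f.
Proof.
by apply/eqP; rewrite eq_complex /=; apply/andP; split; apply/eqP; ring.
Qed.

Lemma Gamma_equidistant (n : nat) (a : 'I_n -> R) (Y : 'I_n -> 'rV[R]_3)
    (f r : R) :
  (forall j k, j != k -> enorm (Y j - Y k) = L) ->
  Gamma (fun j => (a j)%:C) Y (f%:C - 'i%C * r%:C) =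
  coupling (fun j => (a j - r / (4 * pi) + complex.Re (green_value f r)) +i*
                     (complex.Im (green_value f r) - f / (4 * pi)))
           (green_value f r).
Proof.
move=> YL; apply/matrixP => j k; rewrite !mxE /green mul_i_lower.
case: eqVneq => [->|jk].
  rewrite divc_real.
  by apply/eqP; rewrite eq_complex /=; apply/andP; split; apply/eqP; ring.
rewrite YL // sub0r; congr (- _).
have -> : (r +i* f) * L%:C = (L * r) +i* (L * f).
  by apply/eqP; rewrite eq_complex /=; apply/andP; split; apply/eqP; ring.
have -> : cexp ((L * r) +i* (L * f)) =
    (expR (L * r) * cos (L * f)) +i* (expR (L * r) * sin (L * f)).
  by apply/eqP; rewrite eq_complex /=; apply/andP; split; apply/eqP; ring.
by rewrite divc_real; congr Complex; ring.
Qed.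

Lemma Im_green_value (f r t : R) :
  f / (4 * pi) = (1 - t) * complex.Im (green_value f r) <->
  L * f = (1 - t) * (expR (L * r) * sin (L * f)).
Proof.
have pi_neq0 : pi != 0 :> R by rewrite gt_eqF ?pi_gt0.
have L_neq0 : L != 0 by rewrite gt_eqF.
have E : (1 - t) * complex.Im (green_value f r) =
    (1 - t) * (expR (L * r) * sin (L * f)) / L / (4 * pi).
  by rewrite /=; move: (pi) pi_neq0 => p p_neq0; field; rewrite p_neq0.
rewrite E; split => [|<-]; last by rewrite [L * f]mulrC mulfK.
have pi4_neq0 : (4 * pi)^-1 != 0 :> R by rewrite invr_eq0 mulf_neq0.
by move=> /(mulIf pi4_neq0) fE; rewrite [in LHS]fE mulrC divfK.
Qed.

Variables (N : nat) (Y : 'I_N -> 'rV[R]_3).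
Hypothesis Y_equidistant : forall j k, j != k -> enorm (Y j - Y k) = L.

Lemma del_Y_equidistant (alpha : 'I_N -> option R[i]) j k : j != k ->
  enorm (@del_Y R N alpha Y j - @del_Y R N alpha Y k) = L.
Proof. by move=> jk; apply: Y_equidistant; rewrite (inj_eq enum_val_inj). Qed.

(** Necessary condition on every resonance of the family: t is the parameter of
[singular_coupling_Im] for the matrix of the centres with finite alpha_j. *)
Lemma resonance_frequency (f r : R) :
  Sigma_res_family (@F_Rbar R N) Y (f%:C - 'i%C * r%:C) ->
  exists2 t : R, 0 <= t <= N%:R &
    L * f = (1 - t) * (expR (L * r) * sin (L * f)).
Proof.
move=> [_ [a _ <-]] [] + _; rewrite /Sigma /= /det_Gamma.
set alpha := (X in @del_alpha R N X).
have -> : @del_alpha R N alpha = fun j => (odflt 0 (a (enum_val j)))%:C.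
  by apply/funext => j; rewrite /del_alpha /alpha; case: (a _).
rewrite (Gamma_equidistant _ _ _ (@del_Y_equidistant alpha)).
move=> /singular_coupling_Im[t /andP[t_ge0 t_le] tE]; exists t.
  rewrite t_ge0 (le_trans t_le) // ler_nat.
  by rewrite (leq_trans (max_card _)) ?card_ord.
by apply/Im_green_value; lra.
Qed.

(** The condition of [resonance_frequency] matches the imaginary part of the
diagonal with that of t e; the real part is adjusted by the common real value of
the parameters alpha_j. *)
Lemma resonance_at_extreme (f r t : R) :
  (1 < N)%N -> 0 <= r -> t = 0 \/ t = N%:R ->
  L * f = (1 - t) * (expR (L * r) * sin (L * f)) ->
  Sigma_res_family (@F_Rbar R N) Y (f%:C - 'i%C * r%:C).
Proof.
move=> N_gt1 r_ge0 tE /Im_green_value fE.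
(* Chosen so that the diagonal entries of the coupling equal t e. *)
pose a := r / (4 * pi) + (t - 1) * complex.Re (green_value f r).
pose alpha (j : 'I_N) := Some a%:C.
exists alpha; first by exists (fun=> Some a).
split.
  rewrite /Sigma /= /det_Gamma.
  have cardE : #|finite_idx alpha| = N.
    have -> : finite_idx alpha = [set: 'I_N]%SET.
      by apply/setP => j; rewrite !inE.
    by rewrite cardsT card_ord.
  rewrite (Gamma_equidistant (fun=> a) _ _ (@del_Y_equidistant alpha)).
  apply: coupling_singular; rewrite cardE //.
  have -> : (a - r / (4 * pi) + complex.Re (green_value f r)) +i*
      (complex.Im (green_value f r) - f / (4 * pi)) = t%:C * green_value f r.
    apply/eqP; rewrite eq_complex /= fE /a /=.
    by apply/andP; split; apply/eqP; ring.
  case: tE => ->; [left|right]; first by rewrite rmorph0 mul0r.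
  by rewrite rmorph_nat.
move: r_ge0; rewrite le_eqVlt => /predU1P[<-|r_gt0]; [right|left].
  by exists f => //; rewrite rmorph0 mulr0 subr0.
by rewrite /lower_half_plane /=; lra.
Qed.

End Resonances.

(** * Minimal decay *)

Section LeastDecay.
Variable R : realType.

(** Here x and w stand for L f and exp(L r), with r the minimal decay: w is the
least rho >= 1 admitted by the necessary condition, and it is required to be
reached at an end of the range of t, where a resonance does exist. *)
Definition least_growth (N : nat) (x w : R) : Prop :=
  [/\ 1 <= w,
      exists2 t, t = 0 \/ t = N%:R & x = (1 - t) * (w * sin x) &
      forall t rho, 0 <= t <= N%:R -> 1 <= rho ->
        x = (1 - t) * (rho * sin x) -> w <= rho].

Lemma least_growth0 (N : nat) : least_growth N 0 1.
Proof. by split=> //; exists 0; rewrite ?sin0 ?mulr0 //; left. Qed.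

Lemma least_growth_same_sign (N : nat) (x : R) :
  0 < x * sin x -> least_growth N x (x / sin x).
Proof.
move=> xs_gt0; have s_neq0 : sin x != 0.
  by apply: contraTneq xs_gt0 => ->; rewrite mulr0 ltxx.
have w_gt0 : 0 < x / sin x.
  have -> : x / sin x = x * sin x / sin x ^+ 2 by field.
  by rewrite divr_gt0 // exprn_even_gt0.
split.
- rewrite -(gtr0_norm w_gt0) normrM normfV ler_pdivlMr ?normr_gt0 //.
  by rewrite mul1r norm_sin_le.
- by exists 0; [left | rewrite divfK // subr0 mul1r].
move=> t rho /andP[t_ge0 _] rho_ge1 xE.
have wE : x / sin x = (1 - t) * rho by rewrite {1}xE; field.
by rewrite wE; nra.
Qed.

(** Here 1 - t < 0, and |1 - t| is at most 3 because there are four centres. *)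
Lemma least_growth_opposite_sign (x : R) :
  x * sin x < 0 -> least_growth 4 x (- x / (3 * sin x)).
Proof.
move=> xs_lt0; have s_neq0 : sin x != 0.
  by apply: contraTneq xs_lt0 => ->; rewrite mulr0 ltxx.
have w_gt0 : 0 < - x / (3 * sin x).
  have -> : - x / (3 * sin x) = - (x * sin x) / (3 * sin x ^+ 2) by field.
  by rewrite divr_gt0 ?oppr_gt0 // mulr_gt0 // exprn_even_gt0.
split.
- rewrite -(gtr0_norm w_gt0) normrM normfV ler_pdivlMr; last first.
    by rewrite normr_gt0 mulf_neq0.
  by rewrite mul1r normrM normrN (ger0_norm (ler0n _ 3)) norm_sin3_le.
- by exists 4; [right | field].
move=> t rho /andP[_ t_le4] rho_ge1 xE.
have wE : - x / (3 * sin x) = (t - 1) / 3 * rho by rewrite {1}xE; field.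
by rewrite wE; nra.
Qed.

Variables (L : R) (L_gt0 : 0 < L) (N : nat) (N_gt1 : (1 < N)%N).
Variable Y : 'I_N -> 'rV[R]_3.
Hypothesis Y_equidistant : forall j k, j != k -> enorm (Y j - Y k) = L.

Lemma resonance_at_least_decay (f w : R) : least_growth N (L * f) w ->
  Sigma_res_family (@F_Rbar R N) Y (f%:C - 'i * (L^-1 * ln w)%:C)%C.
Proof.
move=> [w_ge1 [t t_ext fE] _].
apply: (resonance_at_extreme L_gt0 Y_equidistant N_gt1 _ t_ext).
  by rewrite mulr_ge0 ?ln_ge0 // invr_ge0 ltW.
by rewrite mulVKf ?gt_eqF // lnK // posrE (lt_le_trans ltr01).
Qed.

Lemma r_min_least_growth (f w : R) : least_growth N (L * f) w ->
  r_min (@F_Rbar R N) Y f = L^-1 * ln w.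
Proof.
move=> fw; have [w_ge1 _ w_min] := fw.
have mem : [set r | 0 <= r /\
    Sigma_res_family (@F_Rbar R N) Y (f%:C - 'i * r%:C)%C] (L^-1 * ln w).
  split; last exact: resonance_at_least_decay.
  by rewrite mulr_ge0 ?ln_ge0 // invr_ge0 ltW.
apply/eqP; rewrite eq_le; apply/andP; split.
  by apply: ge_inf mem; exists 0 => r [].
apply: lb_le_inf; first by exists (L^-1 * ln w).
move=> r [r_ge0 /(resonance_frequency L_gt0 Y_equidistant)[t t_bd fE]].
have rho_ge1 : 1 <= expR (L * r) by rewrite -expR0 ler_expR mulr_ge0 ?(ltW L_gt0).
rewrite mulrC ler_pdivrMr // [r * L]mulrC -[leRHS]expRK ler_ln ?posrE ?expR_gt0 //.
  exact: w_min rho_ge1 fE.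
exact: lt_le_trans w_ge1.
Qed.

Lemma achievable_least_growth (f w : R) : least_growth N (L * f) w ->
  achievable (@F_Rbar R N) Y f.
Proof.
move=> /resonance_at_least_decay H; eexists; first exact: H.
by rewrite /=; ring.
Qed.

Lemma achievable_sin_neq0 (f : R) : achievable (@F_Rbar R N) Y f ->
  sin (L * f) = 0 -> f = 0.
Proof.
move=> [k kres fE] s0.
have kE : k = (f%:C - 'i * (- complex.Im k)%:C)%C.
  by rewrite fE {1}[k]complexE rmorphN mulrN opprK.
rewrite kE in kres.
have [t _] := resonance_frequency L_gt0 Y_equidistant kres.
by rewrite s0 !mulr0 => /eqP; rewrite mulf_eq0 gt_eqF //= => /eqP.
Qed.

End LeastDecay.

(** * The frequency bands of the four-centre tetrahedron *)

Lemma pm_same_sign (R : realType) (L f : R) : 0 < L ->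
  pm (\bigcup_(l in [set: nat])
        [set x : R | 2 * l%:R * pi / L < x < (2 * l%:R + 1) * pi / L]) f ->
  0 < L * f * sin (L * f).
Proof.
move=> L_gt0.
have pos x : (exists2 l, [set: nat] l &
    2 * l%:R * pi / L < x < (2 * l%:R + 1) * pi / L) -> 0 < L * x * sin (L * x).
  move=> [l _]; rewrite ltr_pdivrMr // ltr_pdivlMr // mulrC => /andP[lx xl].
  have lpi_ge0 : 0 <= l%:R * pi :> R by rewrite mulr_ge0 ?pi_ge0.
  have := @signed_sin_gt0 R (L * x) l.*2.
  rewrite -mul2n natrM exprM sqrrN expr1n expr1n mul1r => s_gt0.
  apply: mulr_gt0; first by lra.
  by apply: s_gt0; apply/andP; split; lra.
by move=> [/pos //|[x /pos + <-]]; rewrite mulrN sinN mulrNN.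
Qed.

Lemma pm_opposite_sign (R : realType) (L f : R) : 0 < L ->
  pm (\bigcup_(l in [set l : nat | (1 <= l)%N])
        [set x : R | (2 * l%:R - 1) * pi / L < x < 2 * l%:R * pi / L]) f ->
  L * f * sin (L * f) < 0.
Proof.
move=> L_gt0.
have neg x : (exists2 l, [set l : nat | (1 <= l)%N] l &
    (2 * l%:R - 1) * pi / L < x < 2 * l%:R * pi / L) -> L * x * sin (L * x) < 0.
  move=> [[//|m] _]; rewrite ltr_pdivrMr // ltr_pdivlMr // mulrC mulrSr.
  move=> /andP[lx xl].
  have mpi_ge0 : 0 <= m%:R * pi :> R by rewrite mulr_ge0 ?pi_ge0.
  have pi_gt0 := @pi_gt0 R.
  have := @signed_sin_gt0 R (L * x) m.*2.+1.
  rewrite exprS -mul2n exprM sqrrN expr1n expr1n mulr1 mulN1r oppr_gt0.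
  rewrite mulrSr natrM => s_lt0.
  rewrite pmulr_rlt0; last by lra.
  by apply: s_lt0; apply/andP; split; lra.
by move=> [/neg //|[x /neg + <-]]; rewrite mulrN sinN mulrNN.
Qed.

Theorem theorem7p1 (R : realType) (L : R) (Y : 'I_4 -> 'rV[R]_3)
    (L_gt0 : 0 < L)
    (Y_equidistant : forall j j' : 'I_4, j != j' -> enorm (Y j - Y j') = L) :
  (forall f : R,
     achievable (@F_Rbar R 4) Y f <->
     (forall l : nat, (1 <= l)%N ->
        f <> l%:R * pi / L /\ f <> - (l%:R * pi / L))) /\
  r_min (@F_Rbar R 4) Y 0 = 0 /\
  (forall f : R,
     pm (\bigcup_(l in [set: nat])
           [set x : R | 2 * l%:R * pi / L < x < (2 * l%:R + 1) * pi / L]) f ->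
     r_min (@F_Rbar R 4) Y f = L^-1 * ln (L * f / sin (L * f))) /\
  (forall f : R,
     pm (\bigcup_(l in [set l : nat | (1 <= l)%N])
           [set x : R | (2 * l%:R - 1) * pi / L < x < 2 * l%:R * pi / L]) f ->
     r_min (@F_Rbar R 4) Y f = L^-1 * ln (- (L * f) / (3 * sin (L * f)))).
Proof.
split; last split; last split.
- move=> f; split=> [fach l l_ge1|fN].
    have lpi_neq0 : l%:R * pi / L != 0.
      by rewrite !mulf_neq0 ?invr_eq0 ?gt_eqF ?pi_gt0 ?ltr0n.
    have slpi : sin (L * (l%:R * pi / L)) = 0.
      rewrite [L * _]mulrC divfK ?gt_eqF // -[_ * pi]add0r mulr_natl.
      by rewrite (alternatingn (@sinDpi R)) sin0 mulr0.
    have f0 := achievable_sin_neq0 L_gt0 Y_equidistant fach.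
    split=> fE; case/eqP: lpi_neq0.
      by rewrite -fE f0 // fE.
    by apply/eqP; rewrite -oppr_eq0 -fE f0 // fE mulrN sinN slpi oppr0.
  pose x := L * f.
  have [w fw] : exists w, least_growth 4 x w.
    have [s_lt0|s_gt0|s_eq0] := ltgtP (x * sin x) 0.
    - by eexists; exact: least_growth_opposite_sign.
    - by eexists; exact: least_growth_same_sign.
    (* The excluded frequencies leave x = 0 as the only zero of the sine. *)
    exists 1; suff -> : x = 0 by exact: least_growth0.
    have /eqP := s_eq0; rewrite mulf_eq0 => /orP[/eqP //|/eqP sx0].
    have sx0' : sin `|x| = 0.
      by case: (leP 0 x) => [/ger0_norm|/ltr0_norm] ->; rewrite ?sinN sx0 ?oppr0.
    have [[|n] xE] := sin_eq0_ge0 (normr_ge0 x) sx0'.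
      by apply/eqP; rewrite -normr_eq0 xE mul0r.
    have [fNp fNm] := fN n.+1 isT; exfalso; move: fNp fNm; rewrite -xE.
    have fE : x / L = f by rewrite /x mulrC mulKf ?gt_eqF.
    case: (leP 0 x) => [/ger0_norm|/ltr0_norm] ->; first by rewrite fE.
    by rewrite mulNr opprK fE.
  exact: (achievable_least_growth L_gt0 (N := 4) isT Y_equidistant fw).
- rewrite (r_min_least_growth L_gt0 (N := 4) isT Y_equidistant (w := 1)) ?ln1 ?mulr0 //.
  exact: least_growth0.
- move=> f /(pm_same_sign L_gt0) fs; apply: r_min_least_growth => //.
  exact: least_growth_same_sign.
- move=> f /(pm_opposite_sign L_gt0) fs; apply: r_min_least_growth => //.
  exact: least_growth_opposite_sign.
Qed.
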